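(* For an integer $m\ge0$ let $\mathbf{S}_m=\{1,\dots,m\}^2$; say two squares $(i,j),(i',j')$ are on a common diagonal if $i-j=i'-j'$ or $i+j=i'+j'$. Let $R_{\mathbf{W}}(m,k)$ (resp. $R_{\mathbf{K}}(m,k)$) be the number of $k$-element subsets of $\{(i,j)\in\mathbf{S}_m:i+j\text{ even}\}$ (resp. $i+j$ odd) with no two distinct elements on a common diagonal, and let $B_{\mathbf{S}}(m,k)$ be the number of $k$-element subsets of $\mathbf{S}_m$ with no two distinct elements on a common diagonal. Let $\pi(m)=1$ if $m$ is odd and $0$ otherwise. For integers $k\ge0$, $0\le d\le 2k$ and $\varepsilon\in\{0,1\}$ define $$c^{\mathbf{W}}_d(k,\varepsilon)=\sum_{i=d}^{2k}\frac{(-1)^{i-d}}{i!}\left[{i\atop d}\right]\sum_{p=\max(0,i-k)}^{k}\sum_{j=p}^{k}\left\{\!\!\left\{ {p+j \atop p}\right\}\!\!\right\}\beta_i(p+j,k-j,-\varepsilon),$$ $$c^{\mathbf{K}}_d(k,\varepsilon)=\sum_{i=d}^{2k}\frac{(-1)^{i-d}}{i!}\left[{i\atop d}\right]\sum_{p=\max(0,i-k)}^{k}\sum_{j=p}^{k}\left\{\!\!\left\{ {p+j \atop p}\right\}\!\!\right\}\beta_i(p+j,k-j,\varepsilon).$$ Then for all integers $m,k\ge0$, $$R_{\mathbf{W}}(m,k)=\sum_{d=0}^{2k}c^{\mathbf{W}}_d(k,\pi(m))\,m^d,\qquad R_{\mathbf{K}}(m,k)=\sum_{d=0}^{2k}c^{\mathbf{K}}_d(k,\pi(m))\,m^d,$$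 and $$B_{\mathbf{S}}(m,k)=\sum_{d=0}^{2k}\left(\sum_{j=0}^{k}\sum_{i=0}^{d}c^{\mathbf{W}}_i(j,\pi(m))\,c^{\mathbf{K}}_{d-i}(k-j,\pi(m))\right)m^d,$$ where $c^{\mathbf{W}}_i(j,\varepsilon)$ and $c^{\mathbf{K}}_i(j,\varepsilon)$ are taken to be $0$ when $i>2j$.
   Context: $\left[{i\atop d}\right]$ denotes the unsigned Stirling number of the first kind. $\left\{\!\!\left\{ {n \atop r}\right\}\!\!\right\}$ denotes the associated Stirling number of the second kind, defined for integers $n,r\ge0$ by $\left\{\!\!\left\{ {n \atop r}\right\}\!\!\right\}=r\left\{\!\!\left\{ {n-1 \atop r}\right\}\!\!\right\}+(n-1)\left\{\!\!\left\{ {n-2 \atop r-1}\right\}\!\!\right\}$ with $\left\{\!\!\left\{ {0 \atop r}\right\}\!\!\right\}=\delta_{r0}$, $\left\{\!\!\left\{ {1 \atop r}\right\}\!\!\right\}=0$, $\left\{\!\!\left\{ {n \atop 0}\right\}\!\!\right\}=\delta_{n0}$ (the number of partitions of an $n$-set into $r$ blocks each of size at least 2). For nonnegative integers $p,q$, an integer $z$ and $0\le i\le p+q$, $$\beta_i(p,q,z)=\frac{1}{2^{2q}}\sum_{b=\max(0,i-p)}^{q}2^b\binom{2q-b}{q}\sum_{a=0}^{b}\binom{p+b-q-z}{a}\binom{q+z}{b-a}\binom{a-q}{p+b-i},$$ where $\binom{y}{n}=y(y-1)\cdots(y-n+1)/n!$ for integer $n\ge0$ and any $y$. *)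

(* Defs.v *)
From HB Require Import structures.
From mathcomp Require Import all_boot all_order all_algebra.
Set Implicit Arguments. Unset Strict Implicit. Unset Printing Implicit Defensive.
Import Order.TTheory GRing.Theory Num.Theory.

(* A square of S_m = {1..m}^2 is represented by (i,j) : 'I_m * 'I_m,
   standing for the square (i+1, j+1). *)
Definition row m (x : 'I_m * 'I_m) : nat := (val x.1).+1.
Definition col m (x : 'I_m * 'I_m) : nat := (val x.2).+1.

Definition common_diag m (x y : 'I_m * 'I_m) : bool :=
  ((row x)%:Z - (col x)%:Z == (row y)%:Z - (col y)%:Z)%R
  || (row x + col x == row y + col y).

Definition nonattacking m (A : {set 'I_m * 'I_m}) : bool :=
  [forall x in A, forall y in A, (x != y) ==> ~~ common_diag x y].

Definition white_sq m : {set 'I_m * 'I_m} := [set x | ~~ odd (row x + col x)].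
Definition black_sq m : {set 'I_m * 'I_m} := [set x | odd (row x + col x)].

Definition count_na m (D : {set 'I_m * 'I_m}) (k : nat) : nat :=
  #|[set A : {set 'I_m * 'I_m} | [&& A \subset D, #|A| == k & nonattacking A]]|.

Definition R_W (m k : nat) : nat := count_na (white_sq m) k.
Definition R_K (m k : nat) : nat := count_na (black_sq m) k.
Definition B_S (m k : nat) : nat := count_na [set: 'I_m * 'I_m] k.

Fixpoint stirling1 (n k : nat) : nat :=
  match n, k with
  | 0, 0 => 1
  | 0, _.+1 => 0
  | _.+1, 0 => 0
  | n'.+1, k'.+1 => n' * stirling1 n' k'.+1 + stirling1 n' k'
  end.

Fixpoint assoc_stirling2 (n : nat) : nat -> nat :=
  match n with
  | 0 => fun r => if r == 0 then 1 else 0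
  | 1 => fun _ => 0
  | (n''.+1 as n').+1 => fun r =>
      match r with
      | 0 => 0
      | r'.+1 => r'.+1 * assoc_stirling2 n' r'.+1 + n' * assoc_stirling2 n'' r'
      end
  end.

Local Open Scope ring_scope.

Definition gbinom (y : rat) (n : nat) : rat :=
  (\prod_(l < n) (y - l%:R)) / (n`!)%:R.

Definition beta (i p q : nat) (z : int) : rat :=
  (2 ^+ (2 * q))^-1 *
  \sum_((i - p)%N <= b < q.+1)
     (2 ^+ b * ('C((2 * q - b)%N, q))%:R *
      \sum_(a < b.+1)
        (gbinom ((p + b)%:Z - q%:Z - z)%:~R a
         * gbinom (q%:Z + z)%:~R (b - a)
         * gbinom ((a : nat)%:Z - q%:Z)%:~R (p + b - i))).

Definition inner_sum (i k : nat) (z : int) : rat :=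
  \sum_((i - k)%N <= p < k.+1) \sum_(p <= j < k.+1)
     (assoc_stirling2 (p + j) p)%:R * beta i (p + j) (k - j) z.

Definition c_gen (d k : nat) (z : int) : rat :=
  if (d <= 2 * k)%N then
    \sum_(d <= i < (2 * k).+1)
      (-1) ^+ (i - d) / (i`!)%:R * (stirling1 i d)%:R * inner_sum i k z
  else 0.

Definition pi_par (m : nat) : nat := if odd m then 1 else 0.

Definition cW (d k eps : nat) : rat := c_gen d k (- (eps%:Z)).
Definition cK (d k eps : nat) : rat := c_gen d k (eps%:Z).

(* Main.v *)
Require Import Defs.
From mathcomp Require Import all_boot all_order all_algebra.
From mathcomp Require Import ring lra zify.
Import Order.TTheory GRing.Theory Num.Theory.
Local Open Scope ring_scope.

(** Bishops of one colour are rooks on a Ferrers board: its [m] rows are the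
    diagonals of that colour, in order of increasing length, and the [n]-th one
    (from 0) has length [n] or [n + 1].  Adding a row [L] whose columns include
    all earlier ones gives [r'_(k+1) = r_(k+1) + (#|L| - k) r_k], so [r_k] is the
    coefficient of the falling factorial [x^(m-k)] in [x^A (x + 1)^B], with
    [B = (m - z) / 2] and [A + B = m].  Expanding [(x + 1)^B] and writing
    [S(n, n - r) = sum_p {{p + r, p}} binom(n, p + r)] gives
    [r_k = sum_(j, p) {{p + j, p}} binom(m - k + j, p + j) binom(B, k - j)].
    The numbers [beta_i] re-expand the product
    [binom(m - q, p) binom((m - z) / 2, q)] in the basis [binom(m, i)], by two
    Vandermonde-type convolutions and
    [4^q binom(t + q, q) = sum_b 2^b binom(2q - b, q) binom(2t + b, b)]; signed
    Stirling numbers of the first kind turn [binom(m, i)] into powers of [m].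
    The two colours do not interact, hence the convolution for [B_S]. *)

(** * Generalised binomial coefficients *)

Lemma gbinom0 (y : rat) : gbinom y 0 = 1.
Proof. by rewrite /gbinom big_ord0 fact0 divr1. Qed.

Lemma natS_neq0 (n : nat) : n.+1%:R != 0 :> rat.
Proof. by rewrite pnatr_eq0. Qed.

Lemma fact_neq0 (n : nat) : (n`!)%:R != 0 :> rat.
Proof. by rewrite pnatr_eq0 -lt0n fact_gt0. Qed.

Lemma gbinomS (y : rat) (n : nat) :
  n.+1%:R * gbinom y n.+1 = (y - n%:R) * gbinom y n.
Proof.
rewrite /gbinom big_ord_recr /= factS natrM.
move: (n.+1%:R) (natS_neq0 n) (n`!%:R) (fact_neq0 n) => a a0 b b0.
by field; rewrite a0 b0.
Qed.

Lemma gbinom_absorb (y : rat) (n : nat) :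
  n.+1%:R * gbinom (y + 1) n.+1 = (y + 1) * gbinom y n.
Proof.
rewrite /gbinom big_ord_recl /= factS natrM subr0.
rewrite (eq_bigr (fun l : 'I_n => y - l%:R)); last first.
  by move=> l _; rewrite /bump /= natrD; ring.
move: (n.+1%:R) (natS_neq0 n) (n`!%:R) (fact_neq0 n) => a a0 b b0.
by field; rewrite a0 b0.
Qed.

Lemma gbinom_pascal (y : rat) (n : nat) :
  gbinom (y + 1) n.+1 = gbinom y n.+1 + gbinom y n.
Proof.
apply: (mulfI (natS_neq0 n)).
by rewrite gbinom_absorb mulrDr gbinomS -natr1; ring.
Qed.

Lemma gbinom_nat (n k : nat) : gbinom n%:R k = 'C(n, k)%:R.
Proof.
elim: n k => [|n IHn] [|k]; rewrite ?gbinom0 ?bin0 //.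
  by rewrite bin0n /gbinom big_ord_recl /= subr0 !mul0r.
by rewrite -natr1 gbinom_pascal !IHn binS natrD.
Qed.

(** Induction on [n] after multiplying by [n + 1]: on one side [x + y - n] splits as
    [(x - k) + (y - (n - k))], on the other [n + 1] splits as [k + (n + 1 - k)], and [gbinomS]
    matches the pieces. *)
Lemma gbinom_vandermonde (x y : rat) (n : nat) :
  gbinom (x + y) n = \sum_(k < n.+1) gbinom x k * gbinom y (n - k).
Proof.
elim: n => [|n IHn]; first by rewrite big_ord1 !gbinom0 mulr1.
apply: (mulfI (natS_neq0 n)); rewrite gbinomS IHn mulr_sumr.
transitivity (\sum_(k < n.+1) k.+1%:R * gbinom x k.+1 * gbinom y (n - k)
  + \sum_(k < n.+1) (n.+1 - k)%:R * gbinom x k * gbinom y (n.+1 - k)).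
  rewrite -big_split /=; apply: eq_bigr => k _.
  have hk : (k <= n)%N by rewrite -ltnS.
  rewrite subSn // gbinomS.
  transitivity ((x - k%:R) * gbinom x k * gbinom y (n - k) +
     gbinom x k * ((n - k).+1%:R * gbinom y (n - k).+1)); last by ring.
  by rewrite gbinomS natrB //; ring.
rewrite mulr_sumr.
transitivity (\sum_(k < n.+2) k%:R * gbinom x k * gbinom y (n.+1 - k)
  + \sum_(k < n.+2) (n.+1 - k)%:R * gbinom x k * gbinom y (n.+1 - k)).
  congr (_ + _).
    by rewrite [RHS]big_ord_recl /= !mul0r add0r; apply: eq_bigr => k _; rewrite /bump /= subSS.
  by rewrite [RHS]big_ord_recr /= subnn !mul0r addr0.
rewrite -big_split; apply: eq_bigr => k _ /=.
have hk : (k <= n.+1)%N by rewrite -ltnS.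
by rewrite natrB //; ring.
Qed.

Lemma gbinom_trinomial (x : rat) (a b : nat) :
  gbinom x (a + b) * 'C(a + b, a)%:R = gbinom x a * gbinom (x - a%:R) b.
Proof.
elim: b => [|b IHb]; first by rewrite addn0 binn gbinom0.
apply: (mulfI (natS_neq0 b)).
have hb : b.+1%:R * 'C(a + b.+1, a)%:R = (a + b).+1%:R * 'C(a + b, a)%:R :> rat.
  have symC c : 'C(a + c, a) = 'C(a + c, c) by rewrite -bin_sub ?leq_addr // addKn.
  by rewrite -!natrM !symC addnS -mul_bin_diag.
rewrite mulrCA hb mulrA addnS [_ * (a+b).+1%:R]mulrC gbinomS -mulrA IHb.
rewrite [RHS]mulrCA gbinomS natrD; ring.
Qed.

(* (5.28) in Graham, Knuth and Patashnik, Concrete Mathematics. *)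
Lemma gbinom_mul_expand (A D r : rat) (m n : nat) : A + D = (m + n)%:R ->
  \sum_(k < n.+1) gbinom A k * gbinom D (n - k) * gbinom (r + k%:R) (m + n)
  = gbinom r m * gbinom (r - m%:R + A) n.
Proof.
move=> hAD.
(* Vandermonde expands [gbinom (r + k) (m + n)]; the terms with [j > n >= k] vanish. *)
transitivity (\sum_(k < n.+1) \sum_(j < n.+1)
    gbinom A k * gbinom D (n - k) * ('C(k, j)%:R * gbinom r (m + (n - j)))).
  apply: eq_bigr => k _; rewrite -mulr_sumr; congr (_ * _).
  rewrite addrC gbinom_vandermonde.
  rewrite -(big_mkord predT (fun j => gbinom k%:R j * gbinom r (m + n - j))).
  rewrite (big_cat_nat (n:=n.+1)) ?ltnS ?leq_addl //= big_mkord.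
  rewrite [X in _ + X]big_nat_cond [X in _ + X]big1 ?addr0; last first.
    move=> j /andP[/andP[hj _] _]; rewrite gbinom_nat bin_small ?mul0r //.
    by apply: leq_trans hj; rewrite ltn_ord.
  by apply: eq_bigr => j _; rewrite gbinom_nat addnBA // -ltnS.
rewrite exchange_big /=.
(* By [gbinom_trinomial] the sum over [k] is again a Vandermonde sum, with upper index
   [A - j + D = m + n - j]. *)
transitivity (\sum_(j < n.+1) gbinom A j * 'C(m + (n - j), m)%:R * gbinom r (m + (n - j))).
  apply: eq_bigr => j _.
  under eq_bigr do rewrite mulrA.
  rewrite -mulr_suml; congr (_ * _).
  have hj : (j <= n)%N by rewrite -ltnS.
  rewrite -(big_mkord predT (fun k => gbinom A k * gbinom D (n - k) * 'C(k, j)%:R)).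
  rewrite (big_cat_nat (n:=j)) //=; last exact: leqW.
  rewrite [X in X + _]big_nat_cond [X in X + _]big1 ?add0r; last first.
    by move=> k /andP[/andP[_ hk] _]; rewrite bin_small ?mulr0.
  rewrite -{1}[nat_of_ord j]add0n big_addn subSn // big_mkord.
  transitivity (\sum_(l < (n - j).+1) gbinom A j * (gbinom (A - j%:R) l * gbinom D (n - j - l))).
    apply: eq_bigr => l _.
    rewrite mulrAC addnC gbinom_trinomial subnDA; ring.
  rewrite -mulr_sumr -gbinom_vandermonde; congr (_ * _).
  rewrite addrAC hAD -natrB; last exact: leq_trans hj (leq_addl _ _).
  rewrite -addnBA // gbinom_nat.
  by rewrite -(bin_sub (n:=m + (n-j)) (m:=m)) ?leq_addr // addKn.
rewrite [_ + A]addrC gbinom_vandermonde mulr_sumr; apply: eq_bigr => j _.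
by rewrite -mulrA [X in _ * X]mulrC gbinom_trinomial; ring.
Qed.

(** * The numbers beta *)

(* The coefficient of [t^Q] in [(1 - t)^(-Q-1) (1 - 2t)^(-N-1)]. *)
Definition half_binom_sum (Q : nat) (N : rat) : rat :=
  \sum_(b < Q.+1) 2 ^+ b * 'C(2 * Q - b, Q)%:R * gbinom (N + b%:R) b.

(* Multiplying [(1 - 2t)^(-N-1)] by [1 - (1 - 2t)^2 = 4t(1 - t)]. *)
Lemma half_binom_sum_rec (Q : nat) (N : rat) :
  half_binom_sum Q.+1 N - half_binom_sum Q.+1 (N - 2) = 4 * half_binom_sum Q N.
Proof.
(* [u b] is the coefficient of [t^b] in [(1 - 2t)^(-N-1)], and [w b] that in [t] times this series;
   [stepu] is the multiplication by [4t(1 - t)], read at [t^(c+1)]. *)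
pose u b := 2 ^+ b * gbinom (N + b%:R) b.
pose w b := if b is c.+1 then u c else 0.
have stepu c : 2 ^+ c.+1 * gbinom (N + c.+1%:R) c.+1
    - 2 ^+ c.+1 * gbinom (N - 2 + c.+1%:R) c.+1 = 4 * u c - 4 * w c.
  case: c => [|c]; rewrite /w /u.
    have := gbinomS (N + 1) 0; have := gbinomS (N - 2 + 1) 0.
    rewrite !gbinom0 !mul1r !mulr1 => -> ->; ring.
  have -> : N + c.+2%:R = N + c%:R + 1 + 1 by ring.
  have -> : N - 2 + c.+2%:R = N + c%:R by ring.
  have -> : N + c.+1%:R = N + c%:R + 1 by ring.
  rewrite !gbinom_pascal !exprS; ring.
rewrite /half_binom_sum -sumrB big_ord_recl /= !expr0 !gbinom0 subrr add0r.
under eq_bigr => c _.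
  rewrite /bump /= add1n.
  rewrite -!mulrA ![_ * (_%:R * _)]mulrCA -mulrBr stepu.
  over.
transitivity (4 * (\sum_(c < Q.+1) 'C((2 * Q - c).+1, Q.+1)%:R * u c
   - \sum_(c < Q.+1) 'C((2 * Q - c).+1, Q.+1)%:R * w c)).
  rewrite -sumrB mulr_sumr; apply: eq_bigr => c _.
  have -> : (2 * Q.+1 - c.+1 = (2 * Q - c).+1)%N by have := ltn_ord c; lia.
  ring.
congr (_ * _).
have -> : \sum_(c < Q.+1) 'C((2 * Q - c).+1, Q.+1)%:R * w c
    = \sum_(c < Q.+1) 'C(2 * Q - c, Q.+1)%:R * u c.
  rewrite big_ord_recl mulr0 add0r big_ord_recr /=.
  rewrite (bin_small (n := (2 * Q - Q)%N)) ?mul0r ?addr0; last by lia.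
  apply: eq_bigr => c _; rewrite /bump /= add1n.
  by have -> : ((2 * Q - c.+1).+1 = 2 * Q - c)%N by have := ltn_ord c; lia.
rewrite -sumrB; apply: eq_bigr => c _.
by rewrite binS natrD /u; ring.
Qed.

(** For [N = -2] the series [(1 - 2t)^(-N-1)] is [1 - 2t], and the two surviving terms cancel since
    [binom(2Q+2, Q+1) = 2 binom(2Q+1, Q+1)]. *)
Lemma half_binom_sum_m2 (Q : nat) : half_binom_sum Q.+1 (-2) = 0.
Proof.
rewrite /half_binom_sum !big_ord_recl /= big1 => [|b _]; last first.
  rewrite /bump /= !add1n.
  have -> : -2 + b.+2%:R = b%:R :> rat by ring.
  by rewrite gbinom_nat (bin_small (n := b)) ?mulr0 //; lia.
rewrite /bump /= gbinom0 addr0 add1n.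
have := gbinomS (-2 + 1) 0; rewrite gbinom0 mul1r => ->.
have -> : (2 * Q.+1 - 0 = (2 * Q).+2)%N by lia.
have -> : (2 * Q.+1 - 1 = (2 * Q).+1)%N by lia.
rewrite binS natrD.
have -> : 'C((2 * Q).+1, Q) = 'C((2 * Q).+1, Q.+1).
  rewrite -bin_sub; last by lia.
  by congr 'C(_, _); lia.
ring.
Qed.

(** Both sides have the same increments in [t], by [half_binom_sum_rec] and Pascal's rule, and for
    positive [Q] both vanish at [t = -1]. *)
Lemma half_binom_sumE (Q : nat) (t : int) :
  half_binom_sum Q (2 * t%:~R) = 4 ^+ Q * gbinom (t%:~R + Q%:R) Q.
Proof.
elim: Q t => [t|Q IHQ t].
  by rewrite /half_binom_sum big_ord1 bin0 !gbinom0 !expr0.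
(* This moves the base point [t = -1] to [v = 0]. Stated as an equality of booleans, [shift] serves
   both directions of the integer induction. *)
have [v ->] : exists v : int, t = v - 1 by exists (t + 1); lia.
have shift (x : int) :
  (half_binom_sum Q.+1 (2 * (x + 1 - 1)%:~R)
     == 4 ^+ Q.+1 * gbinom ((x + 1 - 1)%:~R + Q.+1%:R) Q.+1)
  = (half_binom_sum Q.+1 (2 * (x - 1)%:~R)
     == 4 ^+ Q.+1 * gbinom ((x - 1)%:~R + Q.+1%:R) Q.+1).
  have h := half_binom_sum_rec Q (2 * x%:~R).
  rewrite addrK -subr_eq0 -[RHS]subr_eq0; congr (_ == 0).
  have -> : 2 * (x - 1)%:~R = 2 * x%:~R - 2 :> rat by rewrite intrB; ring.
  have -> : (x - 1)%:~R + Q.+1%:R = x%:~R + Q%:R :> rat by rewrite intrB; ring.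
  have -> : x%:~R + Q.+1%:R = x%:~R + Q%:R + 1 :> rat by ring.
  move: h; rewrite IHQ gbinom_pascal exprS => h; lra.
apply/eqP; elim/int_rect: v => [|n IHn|n IHn].
- rewrite sub0r.
  have -> : 2 * (-1)%:~R = -2 :> rat by rewrite mulrNz; ring.
  have -> : (-1)%:~R + Q.+1%:R = Q%:R :> rat by rewrite mulrNz; ring.
  by rewrite half_binom_sum_m2 gbinom_nat bin_small // mulr0.
- have -> : n.+1 = n%:Z + 1 :> int by lia.
  by rewrite shift.
- rewrite -shift.
  by have -> : - n.+1%:Z + 1 - 1 = - n%:Z - 1 :> int by lia.
Qed.

(** The sum over [i] is Vandermonde for [m + (a - Q)]; the sum over [a] is [gbinom_mul_expand] at
    [r = m - Q], which produces the upper index [2(B - Q) + b]; the sum over [b] is then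
    [half_binom_sumE] at [t = B - Q]. *)
Lemma sum_beta_gbinom (P Q m B : nat) (z : int) : m%:Z - z = 2 * B%:Z ->
  \sum_(i < (P + Q).+1) beta i P Q z * gbinom m%:R i
  = gbinom (m%:R - Q%:R) P * gbinom B%:R Q.
Proof.
move=> hz.
have hzr : z%:~R = m%:R - 2 * B%:R :> rat.
  have -> : z = m%:Z - 2 * B%:Z by lia.
  by rewrite intrB intrM.
pose coef (b a : nat) : rat := gbinom ((P + b)%:Z - Q%:Z - z)%:~R a
   * gbinom (Q%:Z + z)%:~R (b - a).
transitivity ((2 ^+ (2 * Q))^-1 * \sum_(b < Q.+1) 2 ^+ b * 'C(2 * Q - b, Q)%:R *
   \sum_(a < b.+1) coef b a * gbinom (m%:R - Q%:R + a%:R) (P + b)).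
  rewrite /beta; under eq_bigr => i _.
    rewrite -mulrA big_geq_mkord mulr_suml; under eq_bigr do rewrite -mulrA mulr_suml.
    over.
  rewrite -mulr_sumr; congr (_ * _).
  rewrite (exchange_big_dep predT) //=; apply: eq_bigr => b _.
  rewrite -mulr_sumr; congr (_ * _).
  rewrite exchange_big /=; apply: eq_bigr => a _.
  under eq_bigr do rewrite -mulrA.
  rewrite -mulr_sumr; congr (_ * _).
  have -> : m%:R - Q%:R + a%:R = m%:R + ((a : nat)%:Z - Q%:Z)%:~R :> rat.
    by rewrite intrB; ring.
  rewrite gbinom_vandermonde (big_ord_widen (P + Q).+1
    (fun i => gbinom m%:R i * gbinom ((a : nat)%:Z - Q%:Z)%:~R (P + b - i))); last first.
    by rewrite ltnS leq_add2l -ltnS.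
  by apply: eq_big => [i|i _]; [rewrite leq_subLR ltnS | rewrite mulrC].
transitivity ((2 ^+ (2 * Q))^-1 * (gbinom (m%:R - Q%:R) P *
    half_binom_sum Q (2 * (B%:Z - Q%:Z)%:~R))).
  congr (_ * _); rewrite /half_binom_sum mulr_sumr; apply: eq_bigr => b _.
  rewrite gbinom_mul_expand; last by rewrite !intrD !intrN natrD; ring.
  rewrite mulrCA; do 2 congr (_ * _).
  congr (gbinom _ _).
  rewrite !intrB hzr PoszD intrD; ring.
rewrite half_binom_sumE intrB subrK exprM.
have -> : (2 ^+ 2 : rat) = 4 by ring.
rewrite mulrCA; congr (_ * _); rewrite mulrA mulVf ?mul1r //.
by rewrite expf_neq0.
Qed.

(** * Stirling numbers of the first kind *)

Lemma stirling1_small (n k : nat) : (n < k)%N -> stirling1 n k = 0%N.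
Proof.
elim: n k => [|n IHn] [|k] //= h.
by rewrite !IHn // ?muln0 // (leq_trans (ltnSn _)) // ltnW.
Qed.

Lemma sum_stirling1 (i : nat) (y : rat) :
  \sum_(d < i.+1) (-1) ^+ (i - d) * (stirling1 i d)%:R * y ^+ d
  = i`!%:R * gbinom y i.
Proof.
elim: i => [|i IHi].
  by rewrite big_ord1 gbinom0 !mulr1.
rewrite factS natrM mulrAC gbinomS mulrAC -mulrA -IHi.
rewrite big_ord_recl /= mulr0 mul0r add0r mulrBl.
under eq_bigr => d _.
  rewrite /bump /= add1n natrD subSS.
  rewrite mulrDr mulrDl.
  over.
rewrite big_split /= addrC; congr (_ + _).
  by rewrite mulr_sumr; apply: eq_bigr => d _; rewrite exprS; ring.
rewrite big_ord_recr /= stirling1_small // muln0 mulr0 mul0r addr0.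
have -> : i%:R * \sum_(d < i.+1) (-1) ^+ (i - d) * (stirling1 i d)%:R * y ^+ d
  = \sum_(d < i) (-1) ^+ (i - d.+1) * (i * stirling1 i d.+1)%:R * y ^+ d.+1 :> rat.
  (* The term [d = 0] vanishes: either [i = 0] or [stirling1 i 0 = 0]. *)
  rewrite big_ord_recl /= mulrDr [X in X + _](_ : _ = 0); last first.
    by case: i {IHi} => [|i] /=; rewrite ?mul0r ?mulr0 ?mul0r ?mulr0.
  rewrite add0r mulr_sumr; apply: eq_bigr => d _.
  by rewrite /bump /= add1n natrM; ring.
rewrite -sumrN; apply: eq_bigr => d _.
rewrite -(subnSK (ltn_ord d)) exprS; ring.
Qed.

(** * Associated Stirling numbers and Ferrers boards *)

#[local] Arguments assoc_stirling2 : simpl never.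

Lemma assoc_stirling2_rec (n r : nat) :
  assoc_stirling2 n.+2 r.+1
  = (r.+1 * assoc_stirling2 n.+1 r.+1 + n.+1 * assoc_stirling2 n r)%N.
Proof. by []. Qed.

Lemma assoc_stirling2_S0 (n : nat) : assoc_stirling2 n.+1 0 = 0%N.
Proof. by case: n. Qed.

Lemma assoc_stirling2_small (n r : nat) : (n < 2 * r)%N -> assoc_stirling2 n r = 0%N.
Proof.
have [N] := ubnP n; elim: N n r => // N IHN [|[|n]] [|r] // hN hr.
rewrite assoc_stirling2_rec !IHN ?muln0 //; lia.
Qed.

(* For natural [x] this is the Stirling number of the second kind
   [S(x, x - r)], counted by the non-singleton blocks. *)
Definition stirling2_codim (x : rat) (r : nat) : rat :=
  \sum_(p < r.+1) (assoc_stirling2 (p + r) p)%:R * gbinom x (p + r).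

Lemma stirling2_codim0 (x : rat) : stirling2_codim x 0 = 1.
Proof. by rewrite /stirling2_codim big_ord1 gbinom0 mulr1. Qed.

(** For natural [x] this is [S(x+1, s) = S(x, s-1) + s S(x, s)] with [s = x - r]. Pascal's rule
    splits off the first term; in the rest the recurrence of the associated numbers gives the
    factors [p] and [x - p - r], whose sum does not depend on [p]. *)
Lemma stirling2_codim_rec (x : rat) (r : nat) :
  stirling2_codim (x + 1) r.+1
  = stirling2_codim x r.+1 + (x - r%:R) * stirling2_codim x r.
Proof.
rewrite /stirling2_codim.
under eq_bigr => p _ do rewrite addnS gbinom_pascal mulrDr.
rewrite big_split /=; congr (_ + _).
  by apply: eq_bigr => p _; rewrite addnS.
rewrite big_ord_recl [assoc_stirling2 _ _](assoc_stirling2_S0 r) mul0r add0r.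
under [LHS]eq_bigr => q _.
  rewrite lift0 addSn (assoc_stirling2_rec (q + r) q) natrD mulrDl.
  over.
rewrite big_split /=.
have -> : \sum_(q < r.+1) (q.+1 * assoc_stirling2 (q + r).+1 q.+1)%:R * gbinom x (q + r).+1
   = \sum_(p < r.+1) p%:R * ((assoc_stirling2 (p + r) p)%:R * gbinom x (p + r)).
  rewrite [RHS]big_ord_recl mul0r add0r big_ord_recr /=.
  rewrite (assoc_stirling2_small (r + r).+1) ?muln0 ?mul0r ?addr0; last by lia.
  by apply: eq_bigr => q _; rewrite /bump /= add1n addSn natrM mulrA.
rewrite mulr_sumr -big_split /=; apply: eq_bigr => p _.
transitivity (p%:R * ((assoc_stirling2 (p + r) p)%:R * gbinom x (p + r))
   + (assoc_stirling2 (p + r) p)%:R * ((p + r).+1%:R * gbinom x (p + r).+1)).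
  by rewrite natrM; ring.
rewrite gbinomS natrD; ring.
Qed.

(* The coefficient of the falling factorial [x^(n-k)] in [x^(n-B) (x+1)^B]. *)
Definition ferrers_coef (n B : rat) (k : nat) : rat :=
  \sum_(i < k.+1) gbinom B i * stirling2_codim (n - i%:R) (k - i).

Lemma ferrers_coef0 (n B : rat) : ferrers_coef n B 0 = 1.
Proof. by rewrite /ferrers_coef big_ord1 gbinom0 stirling2_codim0 mulr1. Qed.

Lemma ferrers_coef_init (k : nat) : ferrers_coef 0 0 k = (k == 0)%:R.
Proof.
case: k => [|k]; first exact: ferrers_coef0.
rewrite /ferrers_coef big1 // => i _.
rewrite (gbinom_nat 0); case: i => [[|i] hi] /=; last by rewrite mul0r.
rewrite subr0 /stirling2_codim big1 ?mulr0 // => p _.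
by rewrite addnS (gbinom_nat 0) bin0n mulr0.
Qed.

(** Multiplication by [x]: in falling factorials, [x * x^(n-k) = x^(n-k+1) + (n - k) x^(n-k)]. *)
Lemma ferrers_coef_mulX (n B : rat) (k : nat) :
  ferrers_coef (n + 1) B k.+1
  = ferrers_coef n B k.+1 + (n - k%:R) * ferrers_coef n B k.
Proof.
rewrite /ferrers_coef big_ord_recr [in RHS]big_ord_recr /= subnn !stirling2_codim0.
rewrite addrAC; congr (_ + _); rewrite mulr_sumr -big_split /=.
apply: eq_bigr => i _; have hi : (i <= k)%N by rewrite -ltnS.
have -> : n + 1 - i%:R = n - i%:R + 1 by ring.
by rewrite subSn // stirling2_codim_rec natrB //; ring.
Qed.

(** Multiplication by [x + 1], which Pascal's rule for [B + 1] reduces to multiplication by [x]. *)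
Lemma ferrers_coef_mulX1 (n B : rat) (k : nat) :
  ferrers_coef (n + 1) (B + 1) k.+1
  = ferrers_coef n B k.+1 + (n + 1 - k%:R) * ferrers_coef n B k.
Proof.
have -> : ferrers_coef (n + 1) (B + 1) k.+1
    = ferrers_coef (n + 1) B k.+1 + ferrers_coef n B k.
  rewrite /ferrers_coef big_ord_recl [in RHS]big_ord_recl /= !gbinom0 -[RHS]addrA.
  congr (_ + _); rewrite -big_split /=; apply: eq_bigr => i _.
  rewrite /bump /= add1n gbinom_pascal subSS.
  have -> : n + 1 - i.+1%:R = n - i%:R by ring.
  ring.
rewrite ferrers_coef_mulX; ring.
Qed.

(** * Re-expansion in powers of [m] *)

Lemma sum_c_gen (m k : nat) (z : int) :
  \sum_(d < (2 * k).+1) c_gen d k z * (m%:R : rat) ^+ d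
  = \sum_(i < (2 * k).+1) inner_sum i k z * gbinom m%:R i.
Proof.
under eq_bigr => d _.
  rewrite /c_gen -ltnS ltn_ord big_geq_mkord mulr_suml.
  over.
rewrite (exchange_big_dep predT) //=; apply: eq_bigr => i _.
have -> : gbinom m%:R i = (i`!%:R)^-1 *
   \sum_(d < i.+1) (-1) ^+ (i - d) * (stirling1 i d)%:R * m%:R ^+ d.
  by rewrite sum_stirling1 mulrA mulVf ?mul1r ?fact_neq0.
rewrite (big_ord_widen (2 * k).+1
  (fun d => (-1) ^+ (i - d) * (stirling1 i d)%:R * m%:R ^+ d)) //.
rewrite mulrA mulr_sumr; apply: eq_bigr => d _; ring.
Qed.

Lemma sum_c_gen_ferrers (m k B : nat) (z : int) : m%:Z - z = 2 * B%:Z ->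
  \sum_(d < (2 * k).+1) c_gen d k z * (m%:R : rat) ^+ d = ferrers_coef m%:R B%:R k.
Proof.
move=> hz; rewrite sum_c_gen /inner_sum.
under eq_bigr => i _.
  rewrite big_geq_mkord mulr_suml.
  under eq_bigr => p _.
    rewrite big_geq_mkord mulr_suml.
    over.
  over.
rewrite (exchange_big_dep predT) //=.
transitivity (\sum_(p < k.+1) \sum_(j < k.+1 | (p <= j)%N)
   (assoc_stirling2 (p + j) p)%:R *
   (gbinom (m%:R - (k - j)%:R) (p + j) * gbinom B%:R (k - j))).
  apply: eq_bigr => p _; rewrite exchange_big /=; apply: eq_bigr => j hj.
  under eq_bigr do rewrite -mulrA.
  rewrite -mulr_sumr; congr (_ * _); rewrite -(sum_beta_gbinom _ _ _ _ _ hz).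
  have hjk := ltn_ord j; have hpk := ltn_ord p.
  (* [i - k <= p] means [i <= p + k = (p + j) + (k - j)], the range in [sum_beta_gbinom]. *)
  rewrite (big_ord_widen (2 * k).+1
    (fun i => beta i (p + j) (k - j) z * gbinom m%:R i)); last by lia.
  by apply: eq_bigl => i; lia.
rewrite (exchange_big_dep predT) //= /ferrers_coef (reindex_inj rev_ord_inj) /=.
apply: eq_bigr => j _; rewrite subSS.
have hj : (j <= k)%N by rewrite -ltnS.
rewrite /stirling2_codim mulr_sumr subKn //.
rewrite (big_ord_widen k.+1 (fun p => gbinom B%:R j *
  ((assoc_stirling2 (p + (k - j)) p)%:R * gbinom (m%:R - j%:R) (p + (k - j))))).
  by apply: eq_big => [p|p _] //; ring.
by rewrite ltnS leq_subr.
Qed.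

(** * Rook placements *)

Section RookPlacements.
Variables (T : finType) (f g : T -> nat).

(** [f] and [g] stand for the row and the column of a square; for bishops they become the diagonal
    and the antidiagonal. *)
Definition rook_set (A : {set T}) : bool :=
  [forall x in A, forall y in A, (x != y) ==> (f x != f y) && (g x != g y)].

Definition rook_placements (D : {set T}) (k : nat) : {set {set T}} :=
  [set A : {set T} | [&& A \subset D, #|A| == k & rook_set A]].

Lemma rook_setP (A : {set T}) :
  reflect (forall x y, x \in A -> y \in A -> x != y -> f x != f y /\ g x != g y)
          (rook_set A).
Proof.
apply: (iffP forall_inP) => [h x y xA yA xy|h x xA].
  by have /forall_inP/(_ y yA)/implyP/(_ xy)/andP := h x xA.
by apply/forall_inP => y yA; apply/implyP => xy; apply/andP; apply: h.
Qed.

Lemma rook_set_sub (A B : {set T}) : A \subset B -> rook_set B -> rook_set A.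
Proof.
by move=> /subsetP sAB /rook_setP hB; apply/rook_setP => x y /sAB xB /sAB yB; apply: hB.
Qed.

Lemma rook_placements0 (D : {set T}) : #|rook_placements D 0| = 1%N.
Proof.
rewrite -(cards1 (set0 : {set T})); apply: eq_card => A; rewrite !inE cards_eq0.
case: eqP => [->|_]; last by rewrite andbF.
by rewrite sub0set; apply/rook_setP => x y; rewrite inE.
Qed.

Lemma rook_placements_set0 (k : nat) : #|rook_placements set0 k| = (k == 0)%N.
Proof.
case: k => [|k]; first exact: rook_placements0.
apply/eqP; rewrite cards_eq0 -subset0; apply/subsetP => A; rewrite !inE subset0.
by case: eqP => [->|_] //; rewrite cards0.
Qed.

Section AddRow.
Variables (D L : {set T}).
Hypothesis fL : {in L &, forall x y, f x = f y}.
Hypothesis fD : {in D & L, forall x y, f x != f y}.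
Hypothesis gL : {in L &, injective g}.
Hypothesis gD : forall x, x \in D -> exists2 y, y \in L & g y = g x.

Definition free_squares (A : {set T}) : {set T} :=
  [set x in L | [forall y in A, g y != g x]].

(* The columns met by a placement in [D] are all columns of the longer row [L]. *)
Lemma card_free_squares (A : {set T}) : A \subset D -> rook_set A ->
  (#|free_squares A| + #|A|)%N = #|L|.
Proof.
move=> /subsetP sAD /rook_setP hA.
(* [c x] is the square of [L] in the column of [x]; by [gD] it exists for [x] in [D], so the default
   is not taken there. *)
pose c x := odflt x [pick y in L | g y == g x].
have cP x : x \in D -> c x \in L /\ g (c x) = g x.
  rewrite /c; case: pickP => [y /andP[yL /eqP ?] _|h /gD[y yL gy]]; first by [].
  by have := h y; rewrite yL gy eqxx.
have cinj : {in A &, injective c}.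
  move=> x y xA yA cxy; apply/eqP/negPn/negP => /(hA _ _ xA yA)[_ /eqP]; apply.
  by rewrite -(proj2 (cP x (sAD x xA))) cxy (proj2 (cP y (sAD y yA))).
rewrite -(card_in_imset cinj) -(cardsID (c @: A) L) addnC; congr (_ + _)%N.
  apply: eq_card => x; rewrite inE; apply/idP/andP => [|[]//].
  by move=> /imsetP[y yA ->]; split; [case: (cP y (sAD y yA)) | apply: imset_f].
apply: eq_card => x; rewrite !inE; case xL: (x \in L); rewrite ?andbF ?andbT //=.
apply/forall_inP/negP => [h /imsetP[y yA xE]|h y yA].
  by have := h y yA; rewrite xE (proj2 (cP y (sAD y yA))) eqxx.
apply/eqP => gyx; apply/h/imsetP; exists y => //.
by have [cL cg] := cP y (sAD y yA); apply: gL => //; rewrite cg.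
Qed.

Definition row_extensions (k : nat) : {set {set T} * T} :=
  [set p | (p.1 \in rook_placements D k) && (p.2 \in free_squares p.1)].

(** Each placement leaves [#|L| - k] squares of [L] free; the additive form avoids truncated
    subtraction. *)
Lemma card_row_extensions (k : nat) :
  (#|row_extensions k| + k * #|rook_placements D k| = #|L| * #|rook_placements D k|)%N.
Proof.
have -> : #|row_extensions k| = (\sum_(A in rook_placements D k) #|free_squares A|)%N.
  rewrite -sum1_card; under [RHS]eq_bigr do rewrite -sum1_card.
  by rewrite pair_big_dep /=; apply: eq_bigl => p; rewrite inE.
rewrite ![(_ * #|rook_placements D k|)%N]mulnC -!sum_nat_const -big_split /=.
apply: eq_bigr => A; rewrite inE => /and3P[sAD /eqP <- hA].
exact: card_free_squares.
Qed.

(** A placement of [k + 1] rooks either lies in [D] or has exactly one rook in the row [L];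
    separating that rook gives an element of [row_extensions]. *)
Lemma rook_placements_add_row (k : nat) :
  (#|rook_placements (D :|: L) k.+1| + k * #|rook_placements D k|
   = #|rook_placements D k.+1| + #|L| * #|rook_placements D k|)%N.
Proof.
have notL (A : {set T}) x : A \subset D -> x \in L -> x \notin A.
  move=> /subsetP sAD xL; apply/negP => /sAD xD.
  by have := fD _ _ xD xL; rewrite eqxx.
rewrite -card_row_extensions addnA; congr (_ + _)%N.
pose ext (p : {set T} * T) := p.2 |: p.1.
have extinj : {in row_extensions k &, injective ext}.
  move=> [A x] [B y]; rewrite !inE /= => /andP[/and3P[sA _ _] /andP[xL _]].
  move=> /andP[/and3P[sB _ _] /andP[yL _]] E.
  have xy : x = y.
    have : x \in y |: B by rewrite -[y |: B]E setU11.
    by rewrite !inE (negbTE (notL B x sB xL)) orbF => /eqP.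
  move: yL E; rewrite -xy /ext /= => _ E; congr (_, _).
  by rewrite -[LHS](setU1K (notL A x sA xL)) -[RHS](setU1K (notL B x sB xL)) E.
rewrite -(card_in_imset extinj) -(cardsID (rook_placements D k.+1)); congr (_ + _)%N.
  apply: eq_card => A; rewrite !inE; apply/andP/idP => [[]//|/and3P[sA cA hA]].
  by rewrite (subset_trans sA (subsetUl _ _)) cA hA sA.
apply: eq_card => A; rewrite !inE.
apply/andP/imsetP => [[hn /and3P[sA /eqP cA hA]]|[[B x]]].
  have sAD : ~~ (A \subset D).
    by apply: contra hn => sAD; rewrite sAD cA eqxx hA.
  have [x xA xD] := subsetPn sAD.
  have xL : x \in L by have := subsetP sA x xA; rewrite inE (negbTE xD).
  have /rook_setP hA' := hA.
  exists (A :\ x, x); last by rewrite /ext /= setD1K.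
  rewrite !inE /= (rook_set_sub _ _ (subsetDl _ _) hA) andbT xL /= -andbA.
  apply/and3P; split.
  - apply/subsetP => y; rewrite !inE => /andP[yx yA].
    have := subsetP sA y yA; rewrite inE => /orP[//|yL].
    by have [] := hA' _ _ yA xA yx; rewrite (fL _ _ yL xL) eqxx.
  - by have := cardsD1 x A; rewrite xA cA => /eqP; rewrite eqSS eq_sym.
  - by apply/forall_inP => y; rewrite !inE => /andP[yx yA]; case: (hA' _ _ yA xA yx).
rewrite !inE /= => /andP[/and3P[sB /eqP cB /rook_setP hB] /andP[xL /forall_inP hx]] ->.
rewrite /ext /=; have xB := notL B x sB xL; split.
  rewrite !negb_and; apply/orP; left; apply/subsetPn; exists x; first exact: setU11.
  by apply/negP => xD; have := fD _ _ xD xL; rewrite eqxx.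
apply/and3P; split.
- by rewrite subUset sub1set inE xL orbT (subset_trans sB (subsetUl _ _)).
- by rewrite cardsU1 xB cB.
- apply/rook_setP => y w; rewrite !inE.
  move=> /orP[/eqP ->|yB] /orP[/eqP ->|wB]; rewrite ?eqxx // => yw.
  + have wD := subsetP sB w wB.
    by split; rewrite eq_sym; [apply: fD | apply: hx].
  + by have yD := subsetP sB y yB; split; [apply: fD | apply: hx].
  + exact: hB.
Qed.

End AddRow.
End RookPlacements.

(** * Bishops *)

Section Board.
Variables (m : nat) (c : bool).
Implicit Types x y : 'I_m * 'I_m.

(* Orders the diagonals of one colour by increasing length: the diagonals
   [i - j = m - 1 - n] and [i - j = n - m] have opposite colours, and rank [n]. *)
Definition diag_rank x : nat :=
  if (x.2 <= x.1)%N then (m.-1 - (x.1 - x.2))%N else (m - (x.2 - x.1))%N.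

Definition antidiag x : nat := (x.1 + x.2)%N.

Definition colour_sq : {set 'I_m * 'I_m} := [set x | odd (antidiag x) == c].

Definition board (n : nat) : {set 'I_m * 'I_m} :=
  [set x in colour_sq | (diag_rank x < n)%N].

Definition board_row (n : nat) : {set 'I_m * 'I_m} :=
  [set x in colour_sq | diag_rank x == n].

Lemma diag_rank_lt x : (diag_rank x < m)%N.
Proof. by rewrite /diag_rank; have := ltn_ord x.1; have := ltn_ord x.2; case: (leqP x.2 x.1); lia. Qed.

Lemma diag_rank_eq x y : x \in colour_sq -> y \in colour_sq ->
  (diag_rank x == diag_rank y) = (x.1 + y.2 == y.1 + x.2)%N.
Proof.
rewrite !inE /antidiag /diag_rank => /eqP hx /eqP hy.
(* Writing both coordinate sums as [c] plus an even number gives [lia] the parity that excludes two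
   diagonals of equal rank. *)
have := odd_double_half (x.1 + x.2); have := odd_double_half (y.1 + y.2).
rewrite hx hy; move: (_./2) (_./2) => u v.
have := ltn_ord x.1; have := ltn_ord x.2; have := ltn_ord y.1; have := ltn_ord y.2.
by case: (leqP x.2 x.1); case: (leqP y.2 y.1) => *; apply/eqP/eqP; lia.
Qed.

Lemma common_diagE x y : x \in colour_sq -> y \in colour_sq ->
  common_diag x y = (diag_rank x == diag_rank y) || (antidiag x == antidiag y).
Proof.
move=> hx hy; rewrite diag_rank_eq // /common_diag /Defs.row /Defs.col /antidiag /=.
by congr (_ || _); apply/eqP/eqP; lia.
Qed.

Lemma nonattackingE (A : {set 'I_m * 'I_m}) : A \subset colour_sq ->
  nonattacking A = rook_set _ diag_rank antidiag A.
Proof.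
move=> /subsetP sA; rewrite /nonattacking /rook_set.
apply/forall_inP/forall_inP => h x xA; apply/forall_inP => y yA;
  by have /forall_inP/(_ y yA) := h x xA; rewrite common_diagE ?sA // negb_or.
Qed.

Lemma antidiag_inj_row (n : nat) : {in board_row n &, injective antidiag}.
Proof.
move=> x y; rewrite !(inE, in_set) => /andP[hx /eqP rx] /andP[hy /eqP ry] sxy.
have hx' : x \in colour_sq by rewrite inE.
have hy' : y \in colour_sq by rewrite inE.
have := diag_rank_eq x y hx' hy'; rewrite rx ry eqxx => /esym/eqP h.
move: sxy h; rewrite /antidiag; case: x y {rx ry hx hy hx' hy'} => [i j] [i' j'] /= h1 h2.
by congr (_, _); apply: val_inj => /=; lia.
Qed.

(** Row [n] is the diagonal [i - j = m - n - 1] if this number has parity [c], and [j - i = m - n]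
    otherwise. The witness is its intersection with the antidiagonal of [x]. *)
Lemma board_row_cover (n : nat) x : (n < m)%N -> x \in board n ->
  exists2 y, y \in board_row n & antidiag y = antidiag x.
Proof.
move=> hn; rewrite !inE => /andP[/eqP hc hr].
have hs := odd_double_half (antidiag x).
case: (boolP (odd (m - n.+1) == c)) => [/eqP|] hp; have hd := odd_double_half (m - n.+1).
- rewrite hp in hd; rewrite hc in hs.
  (* [t] is the smaller coordinate, half of sum minus difference; both have parity [c], so
     subtracting the rounded halves is exact. *)
  pose t := ((antidiag x)./2 - (m - n.+1)./2)%N.
  have [h1 h2 h3] : [/\ t < m, t + (m - n.+1) < m & t + (m - n.+1) + t = antidiag x]%N.
    move: hr hs hd; rewrite /t /diag_rank /antidiag.
    move: (_./2) (_./2) => u v; have := ltn_ord x.1; have := ltn_ord x.2.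
    by case: (leqP x.2 x.1) => *; split; lia.
  exists (Ordinal h2, Ordinal h1); last exact: h3.
  rewrite !inE /antidiag /diag_rank /= h3 hc eqxx /=; case: leqP; lia.
- have hp' : odd (m - n.+1) = ~~ c by case: (odd _) c hp => [] [].
  rewrite hp' in hd; rewrite hc in hs.
  (* For [n = 0] the diagonal [j - i = m] is off the board, but [board 0] has no square to cover. *)
  have [h0 | n0] := posnP n; first by move: hr; rewrite h0.
  pose t := ((antidiag x - (m - n))./2)%N.
  have he : (t.*2 = antidiag x - (m - n) /\ m - n <= antidiag x)%N.
    rewrite /t; have := odd_double_half (antidiag x - (m - n)).
    move: hr hs hd; rewrite /diag_rank /antidiag.
    move: (_./2) (_./2) => u v; have := ltn_ord x.1; have := ltn_ord x.2.
    by case: (leqP x.2 x.1); case: c => *; lia.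
  have [h1 h2 h3] : [/\ t < m, t + (m - n) < m & t + (t + (m - n)) = antidiag x]%N.
    move: he hr hs hd; rewrite /diag_rank /antidiag.
    move: t (_./2) (_./2) => t u v; have := ltn_ord x.1; have := ltn_ord x.2.
    by case: (leqP x.2 x.1) => *; split; lia.
  exists (Ordinal h1, Ordinal h2); last exact: h3.
  rewrite !inE /antidiag /diag_rank /= h3 hc eqxx /=; case: leqP; lia.
Qed.

(** The diagonal [i - j = m - n - 1] has [n + 1] squares and [j - i = m - n] has [n]; [h]
    parametrizes each by its smaller coordinate. *)
Lemma card_board_row (n : nat) : (n < m)%N ->
  #|board_row n| = (n + (odd (m - n.+1) == c))%N.
Proof.
move=> hn.
have hd := odd_double_half (m - n.+1).
case: (boolP (odd (m - n.+1) == c)) => [/eqP|] hp.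
- have p1 (j : 'I_n.+1) : (j + (m - n.+1) < m)%N by have := ltn_ord j; lia.
  have p2 (j : 'I_n.+1) : (j < m)%N by have := ltn_ord j; lia.
  pose h j := (Ordinal (p1 j), Ordinal (p2 j)).
  have hinj : injective h by move=> i j [_ ij]; apply: val_inj.
  rewrite addn1 -[RHS]card_ord -cardsT -(card_imset _ hinj).
  apply: eq_card => -[k l]; apply/idP/imsetP => [|[j _ ->]]; last first.
    rewrite !inE /antidiag /diag_rank /=.
    have -> : odd (j + (m - n.+1) + j) = odd (m - n.+1) by lia.
    by rewrite hp eqxx /=; case: leqP; have := ltn_ord j; lia.
  rewrite !inE /antidiag /diag_rank /= => /andP[/eqP hc hr].
  have := odd_double_half (k + l); rewrite hc => hs; rewrite hp in hd.
  have [hj e1] : (l < n.+1)%N /\ (l + (m - n.+1) = k)%N.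
    move: hr hs hd.
    move: (_./2) (_./2) => u v; have := ltn_ord k; have := ltn_ord l.
    by case: (leqP l k) => *; lia.
  exists (Ordinal hj) => //; by congr (_, _); apply: val_inj => /=; rewrite ?e1.
- have hp' : odd (m - n.+1) = ~~ c by case: (odd _) c hp => [] [].
  have p1 (j : 'I_n) : (j < m)%N by have := ltn_ord j; lia.
  have p2 (j : 'I_n) : (j + (m - n) < m)%N by have := ltn_ord j; lia.
  pose h j := (Ordinal (p1 j), Ordinal (p2 j)).
  have hinj : injective h by move=> i j [ij _]; apply: val_inj.
  rewrite addn0 -[RHS]card_ord -cardsT -(card_imset _ hinj).
  apply: eq_card => -[k l]; apply/idP/imsetP => [|[j _ ->]]; last first.
    rewrite !inE /antidiag /diag_rank /=.
    have -> : odd (j + (j + (m - n))) = ~~ odd (m - n.+1) by lia.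
    by rewrite hp' negbK eqxx /=; case: leqP; have := ltn_ord j; lia.
  rewrite !inE /antidiag /diag_rank /= => /andP[/eqP hc hr].
  have := odd_double_half (k + l); rewrite hc => hs; rewrite hp' in hd.
  have [hj e1] : (k < n)%N /\ (k + (m - n) = l)%N.
    move: hr hs hd.
    move: (_./2) (_./2) => u v; have := ltn_ord k; have := ltn_ord l.
    by case: (leqP l k) => *; lia.
  exists (Ordinal hj) => //; by congr (_, _); apply: val_inj => /=; rewrite ?e1.
Qed.

Lemma boardS (n : nat) : board n.+1 = board n :|: board_row n.
Proof.
by apply/setP => x; rewrite !inE -andb_orr ltnS leq_eqVlt orbC.
Qed.

(** Adding a row of length [n] multiplies the polynomial by [x], and one of length [n + 1] by
    [x + 1]; the second argument of [ferrers_coef] counts rows of the latter kind. *)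
Lemma rook_placements_board (n k : nat) : (n <= m)%N ->
  #|rook_placements _ diag_rank antidiag (board n) k|%:R
  = ferrers_coef n%:R (\sum_(r < n) (odd (m - r.+1) == c))%N%:R k.
Proof.
elim: n k => [|n IHn] k hn.
  have -> : board 0 = set0 by apply/setP => x; rewrite !inE ltn0 andbF.
  by rewrite rook_placements_set0 big_ord0 ferrers_coef_init.
case: k => [|k]; first by rewrite rook_placements0 ferrers_coef0.
have fL : {in board_row n &, forall x y, diag_rank x = diag_rank y}.
  by move=> x y; rewrite !inE => /andP[_ /eqP ->] /andP[_ /eqP ->].
have fD : {in board n & board_row n, forall x y, diag_rank x != diag_rank y}.
  by move=> x y; rewrite !inE => /andP[_ h] /andP[_ /eqP ->]; rewrite neq_ltn h.
have /(congr1 (fun a : nat => a%:R : rat)) := rook_placements_add_row _ _ _ _ _ fL fD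
  (antidiag_inj_row n) (fun x => board_row_cover n x hn) k.
rewrite -boardS card_board_row // !natrD !natrM !IHn; try exact: ltnW.
rewrite big_ord_recr /= -natr1.
case: (_ == c); rewrite ?addn0 ?addn1 ?addr0 -?natr1 => /(canRL (addrK _)) ->.
  by rewrite ferrers_coef_mulX1; ring.
by rewrite ferrers_coef_mulX; ring.
Qed.

Lemma count_na_colour (k : nat) :
  (count_na colour_sq k)%:R
  = ferrers_coef m%:R (if c then m./2 else uphalf m)%:R k.
Proof.
have -> : (if c then m./2 else uphalf m) = (\sum_(r < m) (odd (m - r.+1) == c))%N.
  (* Reversing the ranks leaves the count of numbers below [m] with parity [c]. *)
  rewrite (reindex_inj rev_ord_inj) /=.
  rewrite (eq_bigr (fun r : 'I_m => (odd r == c) : nat)); last first.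
    by move=> r _; have := ltn_ord r => hr; congr (nat_of_bool (odd _ == _)); lia.
  elim: (m) => [|n IHn]; first by rewrite big_ord0; case: c.
  by rewrite big_ord_recr /= -IHn; case: (c); lia.
rewrite -rook_placements_board //; congr (_%:R); apply: eq_card => A.
have -> : board m = colour_sq.
  by apply/setP => x; rewrite inE diag_rank_lt andbT.
by rewrite !inE; case sA: (A \subset _) => //=; rewrite nonattackingE.
Qed.

End Board.

(** * Both colours together *)

Lemma white_sqE (m : nat) : white_sq m = colour_sq m false.
Proof. by apply/setP => -[i j]; rewrite !inE /Defs.row /Defs.col /antidiag /=; lia. Qed.

Lemma black_sqE (m : nat) : black_sq m = colour_sq m true.
Proof. by apply/setP => -[i j]; rewrite !inE /Defs.row /Defs.col /antidiag /=; lia. Qed.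

Lemma common_diag_parity m (x y : 'I_m * 'I_m) :
  common_diag x y -> (x \in white_sq m) = (y \in white_sq m).
Proof.
case: x y => [i j] [i' j']; rewrite !inE /common_diag /Defs.row /Defs.col /=.
by move=> /orP[]/eqP; lia.
Qed.

Lemma nonattackingP m (A : {set 'I_m * 'I_m}) :
  reflect (forall x y, x \in A -> y \in A -> x != y -> ~~ common_diag x y)
          (nonattacking A).
Proof.
apply: (iffP forall_inP) => [h x y xA yA xy|h x xA].
  by have /forall_inP/(_ y yA)/implyP/(_ xy) := h x xA.
by apply/forall_inP => y yA; apply/implyP; apply: h.
Qed.

Lemma black_sqC m : black_sq m = ~: white_sq m.
Proof. by apply/setP => x; rewrite !inE negbK. Qed.

Lemma nonattackingU m (A B : {set 'I_m * 'I_m}) :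
  A \subset white_sq m -> B \subset black_sq m ->
  nonattacking (A :|: B) = nonattacking A && nonattacking B.
Proof.
rewrite black_sqC => /subsetP sA /subsetP sB.
apply/nonattackingP/andP => [h|[/nonattackingP hA /nonattackingP hB] x y].
  by split; apply/nonattackingP => x y xA yA; apply: h; rewrite inE ?xA ?yA ?orbT.
have sB' w : w \in B -> (w \in white_sq m) = false by move=> /sB; rewrite inE => /negbTE.
rewrite !inE => /orP[xA|xB] /orP[yA|yB] xy; [exact: hA| | |exact: hB].
  by apply/negP => /common_diag_parity; rewrite (sA x) // sB'.
by apply/negP => /common_diag_parity; rewrite (sA y) // sB'.
Qed.

Lemma B_S_conv (m k : nat) :
  B_S m k = (\sum_(j < k.+1) R_W m j * R_K m (k - j))%N.
Proof.
rewrite /B_S /count_na -sum1_card.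
(* Placements are sorted by their number of white squares; [inord] loses nothing, as a [k]-set has
   at most [k] of them. *)
rewrite (partition_big (fun A => inord #|A :&: white_sq m| : 'I_k.+1) predT) //=.
apply: eq_bigr => j _; rewrite sum1_card /R_W /R_K /count_na -cardsX.
pose joinU (p : {set 'I_m * 'I_m} * {set 'I_m * 'I_m}) := p.1 :|: p.2.
set X := finset.setX _ _.
have split_white (A B : {set 'I_m * 'I_m}) : A \subset white_sq m ->
    B \subset black_sq m ->
    (A :|: B) :&: white_sq m = A /\ (A :|: B) :&: black_sq m = B.
  rewrite black_sqC => /setIidPl hA; rewrite -disjoints_subset disjoint_sym => hB.
  have hB' : B :&: white_sq m = set0 by apply/eqP; rewrite setI_eq0 disjoint_sym.
  rewrite !setIUl hA hB' setU0; split=> //.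
  rewrite -!setDE -{1}hA setDIl setDv setI0 set0U.
  by rewrite -[RHS](setID B (white_sq m)) hB' set0U.
have jinj : {in X &, injective joinU}.
  move=> [A B] [A' B']; rewrite !inE /= => /andP[/and3P[sA _ _] /and3P[sB _ _]].
  move=> /andP[/and3P[sA' _ _] /and3P[sB' _ _]]; rewrite /joinU /= => E.
  have [a1 a2] := split_white _ _ sA sB; have [b1 b2] := split_white _ _ sA' sB'.
  by congr (_, _); [rewrite -a1 E b1 | rewrite -a2 E b2].
rewrite -(card_in_imset jinj); apply: eq_card => A; rewrite unfold_in /= inE subsetT /=.
have hU : A = (A :&: white_sq m) :|: (A :&: black_sq m).
  by rewrite black_sqC -setDE setID.
have hcard : #|A| = (#|A :&: white_sq m| + #|A :&: black_sq m|)%N.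
  by rewrite black_sqC -setDE cardsID.
apply/andP/imsetP => [[/andP[/eqP cA hA] /eqP hj]|[[B C]]].
  have jE : #|A :&: white_sq m| = j.
    by rewrite -hj inordK // ltnS -cA subset_leq_card // subsetIl.
  exists (A :&: white_sq m, A :&: black_sq m) => //.
  rewrite !inE /= !subsetIr jE eqxx /=.
  move: hA; rewrite {1}hU nonattackingU ?subsetIr // => /andP[-> ->].
  rewrite andbT /=; move: hcard; rewrite cA jE => hk.
  by rewrite [X in (X - _)%N]hk addKn.
rewrite !inE /= => /andP[/and3P[sB /eqP cB hB] /and3P[sC /eqP cC hC]].
rewrite /joinU /= => E; have [eB eC] := split_white _ _ sB sC.
rewrite hcard E eB eC cB cC nonattackingU // hB hC andbT; split; last first.
  by apply/eqP/val_inj; rewrite /= inordK.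
have hjk : (j <= k)%N by rewrite -ltnS.
by rewrite subnKC // eqxx.
Qed.

(** A product of two polynomials evaluated at [x]; the vanishing hypotheses identify [u] and [v]
    with the coefficient sequences beyond [p] and [q]. *)
Lemma cauchy_product (u v : nat -> rat) (p q : nat) (x : rat) :
  (forall i, (p < i)%N -> u i = 0) -> (forall i, (q < i)%N -> v i = 0) ->
  (\sum_(i < p.+1) u i * x ^+ i) * (\sum_(i < q.+1) v i * x ^+ i)
  = \sum_(d < (p + q).+1) (\sum_(i < d.+1) u i * v (d - i)%N) * x ^+ d.
Proof.
move=> hu hv.
rewrite -!horner_poly -hornerM (horner_coef_wide (n := (p + q).+1)).
  apply: eq_bigr => d _; rewrite coefM; congr (_ * _); apply: eq_bigr => i _.
  rewrite !coef_poly; congr (_ * _); case: ltnP => // h; first by rewrite hu.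
  by rewrite hv.
apply: leq_trans (size_polyMleq _ _) _.
move: (size_poly p.+1 u) (size_poly q.+1 v).
by move: (size _) (size _) => a b; lia.
Qed.

Theorem theorem2p6 (m k : nat) :
  [/\ (R_W m k)%:R = \sum_(d < (2 * k).+1) cW d k (pi_par m) * (m%:R : rat) ^+ d,
      (R_K m k)%:R = \sum_(d < (2 * k).+1) cK d k (pi_par m) * (m%:R : rat) ^+ d
    & (B_S m k)%:R =
        \sum_(d < (2 * k).+1)
          (\sum_(j < k.+1) \sum_(i < d.+1)
             cW i j (pi_par m) * cK (d - i) (k - j) (pi_par m)) * (m%:R : rat) ^+ d].
Proof.
(* With [eps = pi_par m], white has [z = -eps] and [m + eps = 2 * uphalf m], black has [z = eps] and
   [m - eps = 2 * m./2]. *)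
have hW j : (R_W m j)%:R = \sum_(d < (2 * j).+1) cW d j (pi_par m) * (m%:R : rat) ^+ d.
  rewrite /R_W white_sqE count_na_colour (sum_c_gen_ferrers _ _ (uphalf m)) //.
  by rewrite /pi_par; case: ifP; lia.
have hK j : (R_K m j)%:R = \sum_(d < (2 * j).+1) cK d j (pi_par m) * (m%:R : rat) ^+ d.
  rewrite /R_K black_sqE count_na_colour (sum_c_gen_ferrers _ _ m./2) //.
  by rewrite /pi_par; case: ifP; lia.
split=> //; rewrite B_S_conv natr_sum.
under [RHS]eq_bigr do rewrite mulr_suml.
rewrite [RHS]exchange_big /=; apply: eq_bigr => j _.
rewrite natrM hW hK (cauchy_product
  (fun i => cW i j (pi_par m)) (fun i => cK i (k - j)%N (pi_par m))).
- have -> // : (2 * j + 2 * (k - j) = 2 * k)%N by have := ltn_ord j; lia.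
- by move=> i hi; rewrite /cW /c_gen leqNgt hi.
- by move=> i hi; rewrite /cK /c_gen leqNgt hi.
Qed.
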